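(* Let $X$ be a real or complex normed linear space (not necessarily complete) with norm $\|\cdot\|$, let $1\leq p<\infty$, and let $(u_k)_{k=0}^{\infty}$ be a sequence in $X$. Suppose that the series $\sum_{k=0}^\infty u_k$ is $(C,1)$ summable in $X$ to a vector $S\in X$ and that $$\sum_{k=n+1}^\infty \|u_{k}\|^p = O\left( \frac{1}{n^{p-1}} \right)\quad\text{as } n\to\infty.$$ Then the series $\sum_{k=0}^\infty u_k$ converges to $S$ in $X$.
   Context: For a sequence $(u_k)_{k=0}^\infty$ in a normed space $X$ put $S_n:=\sum_{k=0}^n u_k$ and $\sigma_n:=\frac{S_0+S_1+\dots+S_n}{n+1}$ for integers $n\ge 0$. The series $\sum_{k=0}^\infty u_k$ is called $(C,1)$ summable in $X$ to $S\in X$ if $\sigma_n\to S$ in $X$ as $n\to\infty$. The series converges to $S$ in $X$ if $S_n\to S$ in $X$ as $n\to\infty$. *)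

(* Defs.v *)
From mathcomp Require Export all_boot all_order all_algebra.
From mathcomp Require Export all_classical all_reals all_analysis.
From mathcomp Require Export complex.
Set Implicit Arguments.
Unset Strict Implicit.
Unset Printing Implicit Defensive.
Import Order.TTheory GRing.Theory Num.Theory numFieldNormedType.Exports.
Local Open Scope classical_set_scope.
Local Open Scope ring_scope.

(* The library's [series u n] is the sum of the first n terms, whence the
   shift: the last term of [partial_sum u n] is [u n]. *)
Definition partial_sum (V : zmodType) (u : nat -> V) : nat -> V :=
  fun n => series u n.+1.

Definition cesaro_mean (K : numFieldType) (X : lmodType K) (u : nat -> X)
    : nat -> X :=
  fun n => n.+1%:R^-1 *: \sum_(0 <= k < n.+1) partial_sum u k.

Definition C1_summable_to (K : numFieldType) (X : normedModType K)
    (u : nat -> X) (S : X) : Prop :=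
  cesaro_mean u @ \oo --> S.

Definition series_converges_to (K : numFieldType) (X : normedModType K)
    (u : nat -> X) (S : X) : Prop :=
  partial_sum u @ \oo --> S.

Definition tail_sum (R : realType) (a : nat -> R) (n : nat) : R :=
  limn (fun m => \sum_(n.+1 <= k < m) a k).

(* [a] is the sequence of norms. [tail_sum] takes an arbitrary value on a
   divergent series: hence the convergence clause, implicit in a O-bound on
   the tails. *)
Definition tail_condition (R : realType) (p : R) (a : nat -> R) : Prop :=
  cvgn (series (fun k => a k `^ p)) /\
  (tail_sum (fun k => a k `^ p) : nat -> R^o) =O_\oo
    (fun n => 1 / n%:R `^ (p - 1) : R^o).

(* A norm over R[i] takes (real) values in R[i]. *)
Definition complex_norm (R : realType) (X : normedModType R[i]) (x : X) : R :=
  complex.Re `|x|.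

(* Main.v *)
(* If the block sums of the norms over n < k <= m are small as soon as
   (m - n) / n is small and n is large, then the partial sums S_n oscillate
   slowly, and comparing S_n with the moving average of S_(n+1), ..., S_(n+L),
   which is controlled by the Cesaro means since L is comparable to n, gives
   S_n --> S without completeness of X.
   For p > 1 the tail hypothesis bounds the block sum by
   d + C ((m - n) / (d n))^(p - 1) for every d > 0; for p = 1 it only says
   that the series of norms converges, which makes the block sums small
   directly. *)
Require Import Defs.
From mathcomp Require Import zify lra.
Import Order.TTheory GRing.Theory Num.Theory numFieldNormedType.Exports.
Local Open Scope classical_set_scope.
Local Open Scope ring_scope.

(** The integer [q] is the reciprocal of the allowed ratio (m - n) / n, so that the condition on [n]
    and [m] lives in [nat] and reads the same over real and complex scalars. *)
Definition slowly_oscillating {K : numFieldType} {X : normedModType K}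
    (s : nat -> X) : Prop :=
  forall e : K, 0 < e -> exists2 q : nat, (0 < q)%N &
    exists N : nat, forall n m : nat, (N <= n)%N -> (n <= m)%N ->
      ((m - n) * q <= n)%N -> `|s m - s n| <= e.

Lemma slow_oscillation_tauberian (K : numFieldType) (X : normedModType K)
    (s : nat -> X) (S : X) :
  (fun n => n.+1%:R^-1 *: \sum_(0 <= k < n.+1) s k) @ \oo --> S ->
  slowly_oscillating s -> s @ \oo --> S.
Proof.
move=> /cvgrPdist_le mean_cvg osc; apply/cvgrPdist_le => e e0.
have [q q0 [N1 oscN]] := osc (e / 2) (divr_gt0 e0 (ltr0n _ 2)).
(* Large enough for [D_total]: with L = floor(n / q) >= 1, n + 1 <= (L + 1) q <= 2 L q, hence (n + L
   + 1) + (n + 1) <= L c. *)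
pose c : nat := (8 * q).+1.
pose h : K := e / 2 / c%:R.
have h0 : 0 < h by rewrite !divr_gt0 ?ltr0n.
have [N2 _ meanN] := mean_cvg h h0.
pose D m := \sum_(0 <= k < m) (s k - S).
have D_le m : (N2 <= m)%N -> `|D m.+1| <= m.+1%:R * h.
  move=> /meanN /=; rewrite distrC => meanm.
  have -> : D m.+1 =
      m.+1%:R *: (m.+1%:R^-1 *: (\sum_(0 <= k < m.+1) s k) - S).
    rewrite /D sumrB sumr_const_nat subn0 scalerBr scalerA divff ?pnatr_eq0 //.
    by rewrite scale1r scaler_nat.
  by rewrite normrZ normr_nat ler_wpM2l.
exists (N1 + N2 + q)%N => // n /= len.
(* The longest block after [n] on which slow oscillation applies; n >= q makes it nonempty. *)
pose L := (n %/ q)%N.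
have L0 : (0 < L)%N by rewrite divn_gt0 //; lia.
have nlt : (n < L.+1 * q)%N by rewrite ltn_ceil.
have Lqn : (L * q <= n)%N by rewrite leq_trunc_div.
(* Sum s n - S = (s k - S) - (s k - s n) over the block n < k <= n + L. *)
have decomp : (s n - S) *+ L = D (n + L).+1 - D n.+1
    - \sum_(n.+1 <= k < (n + L).+1) (s k - s n).
  rewrite -[D _]/(series (fun k => s k - S) _) -[D n.+1]/(series _ _).
  rewrite sub_series_geq ?ltnS ?leq_addr // -sumrB.
  rewrite (eq_bigr (fun=> s n - S)).
    by rewrite sumr_const_nat subSS addKn.
  by move=> k _; rewrite opprB addrC addrA subrK.
have block_le :
    `|\sum_(n.+1 <= k < (n + L).+1) (s k - s n)| <= L%:R * (e / 2).
  apply: (le_trans (ler_norm_sum _ _ _)).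
  apply: (@le_trans _ _ (\sum_(n.+1 <= k < (n + L).+1) (e / 2))).
    rewrite big_seq_cond [leRHS]big_seq_cond; apply: ler_sum => k.
    rewrite mem_index_iota andbT => /andP[nk kL]; apply: oscN; [lia|lia|].
    apply: leq_trans Lqn; rewrite leq_mul2r; lia.
  by rewrite sumr_const_nat subSS addKn mulr_natl.
have D_total : (n + L).+1%:R * h + n.+1%:R * h <= L%:R * (e / 2).
  rewrite -mulrDl -natrD /h [leLHS]mulrA ler_pdivrMr ?ltr0n // mulrAC.
  rewrite ler_pM2r ?divr_gt0 //.
  by rewrite -natrM ler_nat /c; nia.
rewrite distrC -(ler_pM2l (_ : 0 < L%:R)) ?ltr0n //.
rewrite [leLHS]mulr_natl -normrMn decomp.
apply: (le_trans (ler_normB _ _)).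
rewrite [in leRHS](splitr e) mulrDr lerD //.
apply: (le_trans (ler_normB _ _)); apply: le_trans D_total.
by rewrite lerD // D_le //; lia.
Qed.

(* Summed over a block of L terms with d replaced by d / L, this pointwise
   bound plays the role of Hölder's inequality. *)
Lemma le_add_powR (R : realType) (p d x : R) :
  1 <= p -> 0 < d -> 0 <= x -> x <= d + x `^ p / d `^ (p - 1).
Proof.
move=> p1 d0 x0; have dp0 := powR_gt0 (p - 1) d0.
have [xd|dx] := lerP x d.
  by rewrite -[x]addr0 lerD // divr_ge0 ?powR_ge0.
rewrite -(mulr_powRB1 x0 (lt_le_trans ltr01 p1)) -[x in leLHS]add0r.
rewrite lerD ?(ltW d0) // -mulrA ler_peMr // ler_pdivlMr // mul1r.
by rewrite ge0_ler_powR ?subr_ge0 ?nnegrE ?(ltW d0) ?(ltW dx).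
Qed.

Lemma block_le_tail_sum (R : realType) (a : nat -> R) (n m : nat) :
  (forall k, 0 <= a k) -> cvgn (series a) ->
  \sum_(n.+1 <= k < m) a k <= tail_sum a n.
Proof.
move=> a0 cvga; apply: (nondecreasing_cvgn_le _ _ m).
  by apply: nondecreasing_series => k _ _.
rewrite -(is_cvg_series_restrict n.+1) in cvga; exact: cvga.
Qed.

(** Stated for a real sequence, so that it applies to the norms over either scalar field. *)
Lemma slowly_varying_blocks (R : realType) (p : R) (a : nat -> R) :
  1 <= p -> (forall k, 0 <= a k) -> tail_condition p a ->
  forall e : R, 0 < e -> exists2 q : nat, (0 < q)%N &
    exists N : nat, forall n m : nat, (N <= n)%N -> (n <= m)%N ->
      ((m - n) * q <= n)%N -> \sum_(n.+1 <= k < m.+1) a k <= e.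
Proof.
move=> p1 a0 [cvga tailO] e e0.
(* The exponent 1 / (p - 1) used below requires p > 1. For p = 1 the partial sums of [a] increase to
   their limit, so late blocks are small whatever their length. *)
have [p_eq1|p_neq1] := eqVneq p 1.
  have aE : (fun k => a k `^ p) = a.
    by apply/funext => k; rewrite p_eq1 powRr1.
  have cvg1 : cvgn (series a) by rewrite -aE.
  have ser_homo : {homo series a : n m / (n <= m)%N >-> n <= m}.
    by apply: nondecreasing_series => k _ _.
  exists 1%N => //; have /cvgrPdist_le/(_ e e0) [N _ serN] := cvg1.
  exists N => n m Nn nm _; rewrite -sub_series_geq ?ltnS //.
  have := serN n.+1 (leqW Nn); have := nondecreasing_cvgn_le ser_homo cvg1 m.+1.
  by rewrite /= ler_norml => ? /andP[_ ?]; lra.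
have h0 : 0 < p - 1 by rewrite subr_gt0 lt_def p_neq1.
have /eqO_exP [C C0 [N _ tailN]] := tailO.
pose d := e / 2; have d0 : 0 < d by rewrite divr_gt0.
(* The ratio L / n at which C (L / (d n))^(p - 1) equals [d]; any [q] above 1 / t then forces L / n
   <= t. *)
pose t := d / (C / d) `^ (p - 1)^-1.
have t0 : 0 < t by rewrite divr_gt0 ?powR_gt0 ?divr_gt0.
have tE : (d / t) `^ (p - 1) = C / d.
  rewrite /t invf_div mulrCA divff ?gt_eqF // mulr1 -powRrM mulVf ?gt_eqF //.
  by rewrite powRr1 // divr_ge0 ?ltW.
pose q := (Num.trunc t^-1).+1; have tq : t^-1 < q%:R by exact: truncnS_gt.
exists q => //; exists N.+1 => n m Nn nm.
set L := (m - n)%N => Lqn; rewrite -(subnKC nm) -/L.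
have [->|L_neq0] := eqVneq L 0%N; first by rewrite addn0 big_geq ?ltW.
have n0 : 0 < n%:R :> R by rewrite ltr0n; lia.
have L0 : 0 < L%:R :> R by rewrite ltr0n lt0n.
have Ln : L%:R / n%:R <= t.
  rewrite ler_pdivrMr // mulrC -ler_pdivrMr //.
  rewrite (le_trans _ (_ : L%:R * q%:R <= _)) //.
    by rewrite ler_wpM2l // ltW.
  by rewrite -natrM ler_nat.
pose dL := d / L%:R; have dL0 : 0 < dL by rewrite divr_gt0.
have bound_sum : \sum_(n.+1 <= k < (n + L).+1) a k
    <= d + (\sum_(n.+1 <= k < (n + L).+1) a k `^ p) / dL `^ (p - 1).
  have -> : d = \sum_(n.+1 <= k < (n + L).+1) dL.
    by rewrite sumr_const_nat subSS addKn -mulr_natr divfK ?gt_eqF.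
  by rewrite mulr_suml -big_split ler_sum // => k _; exact: le_add_powR.
apply: (le_trans bound_sum); rewrite (splitr e) lerD2l.
rewrite ler_pdivrMr ?powR_gt0 //.
have /le_trans -> // := block_le_tail_sum _ _ n (n + L).+1
  (fun k => powR_ge0 (a k) p) cvga.
apply: (le_trans (ler_norm _)); apply: (le_trans (tailN n (ltnW Nn))).
rewrite ger0_norm ?divr_ge0 ?powR_ge0 // div1r ler_pdivrMr ?powR_gt0 //.
(* What remains is C / d <= (d n / L)^(p - 1). The left side is (d / t)^(p - 1), so L / n <= t
   suffices. *)
rewrite -mulrA -powRM ?(ltW dL0) ?(ltW n0) //.
rewrite mulrC -ler_pdivrMr // -tE ge0_ler_powR ?(ltW h0) ?nnegrE //.
- by rewrite divr_ge0 ?ltW.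
- by rewrite mulr_ge0 ?ltW.
rewrite /dL -mulrA ler_pM2l // mulrC.
by rewrite -[leRHS]invrK [(n%:R / _)^-1]invf_div lef_pV2 ?posrE ?t0 ?divr_gt0.
Qed.

Lemma slowly_oscillating_partial_sum (K : numFieldType) (X : normedModType K)
    (u : nat -> X) :
  (forall e : K, 0 < e -> exists2 q : nat, (0 < q)%N &
    exists N : nat, forall n m : nat, (N <= n)%N -> (n <= m)%N ->
      ((m - n) * q <= n)%N -> \sum_(n.+1 <= k < m.+1) `|u k| <= e) ->
  slowly_oscillating (partial_sum u).
Proof.
move=> blocks e /blocks [q q0 [N blocksN]]; exists q => //.
exists N => n m Nn nm mn.
rewrite /partial_sum sub_series_geq ?ltnS //.
exact: le_trans (ler_norm_sum _ _ _) (blocksN _ _ Nn nm mn).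
Qed.

Theorem theorem2p1 (R : realType) :
  (forall (X : normedModType R) (p : R) (u : nat -> X) (S : X),
     1 <= p ->
     C1_summable_to u S ->
     tail_condition p (fun k => `|u k|) ->
     series_converges_to u S)
  /\
  (forall (X : normedModType R[i]) (p : R) (u : nat -> X) (S : X),
     1 <= p ->
     C1_summable_to u S ->
     tail_condition p (fun k => complex_norm (u k)) ->
     series_converges_to u S).
Proof.
split=> X p u S p1 mean_cvg tail.
  apply: (slow_oscillation_tauberian _ _ _ _ mean_cvg).
  apply: slowly_oscillating_partial_sum.
  by apply: (slowly_varying_blocks _ _ _ p1 _ tail) => k.
apply: (slow_oscillation_tauberian _ _ _ _ mean_cvg).
apply: slowly_oscillating_partial_sum => e e0.
(* Norms and positive elements of [R[i]] are real, so the estimate can be made in [R] on real parts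
   and carried back along the embedding. *)
have normE x : `|x : X| = (complex_norm x)%:C%C.
  by rewrite /complex_norm RRe_real // normr_real.
have norm0 (x : X) : 0 <= complex_norm x.
  by rewrite -lecR -normE normr_ge0.
have eE : e = (complex.Re e)%:C%C by rewrite RRe_real ?gtr0_real.
have Re0 : 0 < complex.Re e by rewrite -ltcR -eE.
have [q q0 [N blocksN]] :=
  slowly_varying_blocks _ _ _ p1 (fun k => norm0 (u k)) tail _ Re0.
exists q => //; exists N => n m Nn nm mn.
under eq_bigr => k _ do rewrite normE.
by rewrite -rmorph_sum /= eE lecR (blocksN _ _ Nn nm mn).
Qed.
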